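(* Let $n\in\mathbb{N}$. Then $\mathbb{R}^{n\times n}=B_n\oplus A_n=S_n\oplus V_n=N_n\oplus M_n$ (direct sums of vector subspaces). If $n$ is even, then also $\mathbb{R}^{n\times n}=Q_n\oplus P_n$.
   Context: Matrix indices are taken in $\mathbb{Z}_n=\mathbb{Z}/n\mathbb{Z}$ (computed modulo $n$), the top left entry having index $(1,1)$. $\sigma_n\in\mathbb{R}^n$ is the column vector with $j$th entry $(-1)^{j-1}$; $X^\bot=\{u\in\mathbb{R}^n\mid u^Tv=0\ (v\in X)\}$. The spaces of matrices $M\in\mathbb{R}^{n\times n}$ are defined as follows. $S_n$: there is $w\in\mathbb{R}$ such that $\sum_{j}M_{i,j}=\sum_{j}M_{j,i}=nw$ for all $i$. $A_n$: $M_{i,j}+M_{n+1-i,n+1-j}=0$ for all $i,j$. $B_n$: $M_{i,j}-M_{n+1-i,n+1-j}=0$ for all $i,j$. $V_n$: $M_{i,j}+M_{k,l}=M_{i,l}+M_{k,j}$ for all $i,j,k,l$, and $\sum_{i,j=1}^nM_{i,j}=0$. For even $n=2\nu$: $M_n$: $M_{i,j}+M_{i,j+1}+M_{i+1,j}+M_{i+1,j+1}=0$ for all $i,j\in\mathbb{Z}_n$, and $\sum_{i,j\in\mathbb{Z}_n}(-1)^{i+j}M_{i,j}=0$. $N_n$: $\sum_{i\in\mathbb{Z}_n}(-1)^i(M_{i,j}+M_{i,j+1})=\sum_{i\in\mathbb{Z}_n}(-1)^i(M_{j,i}+M_{j+1,i})=0$ for all $j\in\mathbb{Z}_n$. $P_n$: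 $M_{i,j}+M_{i+\nu,j+\nu}=0$ for all $i,j\in\mathbb{Z}_n$. $Q_n$: $M_{i,j}-M_{i+\nu,j+\nu}=0$ for all $i,j\in\mathbb{Z}_n$. For odd $n$ one defines instead $M_n=\{M\in\mathbb{R}^{n\times n}\mid u^TMv=0\ (u,v\in\{\sigma_n\}^\bot),\ \sigma_n^TM\sigma_n=0\}$ and $N_n=\{M\in\mathbb{R}^{n\times n}\mid \sigma_n^TMu=0=u^TM\sigma_n\ (u\in\{\sigma_n\}^\bot)\}$. *)

(* Defs.v *)
From HB Require Import structures.
From mathcomp Require Import all_boot all_order all_algebra.
From mathcomp Require Import boolp classical_sets reals.

Import Order.TTheory GRing.Theory Num.Theory.

Local Open Scope classical_set_scope.
Local Open Scope ring_scope.

(* The ordinal i : 'I_n stands for the index i + 1 of Z/nZ, so that ord0 is   *)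
(* the index 1 of the top left entry.  Hence [ordS i] is "i + 1" modulo n,    *)
(* [rev_ord i] is "n + 1 - i", and a sign (-1)^i of a 1-based index i is      *)
(* written (-1) ^+ i.+1.                                                      *)

Section Spaces.
Variables (R : realType) (n : nat).

Definition ord_shift (k : nat) (i : 'I_n) : 'I_n := iter k (@ordS n) i.

Definition sigma : 'cV[R]_n := \col_(j < n) (-1) ^+ j.

Definition orth (X : set 'cV[R]_n) : set 'cV[R]_n :=
  [set u | forall v, X v -> u^T *m v = 0].

Definition space_S : set 'M[R]_n :=
  [set M : 'M[R]_n | exists w : R, forall i : 'I_n,
     \sum_j M i j = n%:R * w /\ \sum_j M j i = n%:R * w].

Definition space_A : set 'M[R]_n :=
  [set M : 'M[R]_n | forall i j : 'I_n, M i j + M (rev_ord i) (rev_ord j) = 0].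

Definition space_B : set 'M[R]_n :=
  [set M : 'M[R]_n | forall i j : 'I_n, M i j - M (rev_ord i) (rev_ord j) = 0].

Definition space_V : set 'M[R]_n :=
  [set M : 'M[R]_n | (forall i j k l : 'I_n, M i j + M k l = M i l + M k j) /\
           \sum_i \sum_j M i j = 0].

Definition space_M_even : set 'M[R]_n :=
  [set M : 'M[R]_n | (forall i j : 'I_n,
              M i j + M i (ordS j) + M (ordS i) j + M (ordS i) (ordS j) = 0) /\
           \sum_(i < n) \sum_(j < n) (-1) ^+ (i.+1 + j.+1) * M i j = 0].

Definition space_M_odd : set 'M[R]_n :=
  [set M : 'M[R]_n | (forall u v : 'cV[R]_n,
              orth [set sigma] u -> orth [set sigma] v -> u^T *m M *m v = 0) /\
           sigma^T *m M *m sigma = 0].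

Definition space_M : set 'M[R]_n := if odd n then space_M_odd else space_M_even.

Definition space_N_even : set 'M[R]_n :=
  [set M : 'M[R]_n | forall j : 'I_n,
     \sum_(i < n) (-1) ^+ i.+1 * (M i j + M i (ordS j)) = 0 /\
     \sum_(i < n) (-1) ^+ i.+1 * (M j i + M (ordS j) i) = 0].

Definition space_N_odd : set 'M[R]_n :=
  [set M : 'M[R]_n | forall u : 'cV[R]_n, orth [set sigma] u ->
     sigma^T *m M *m u = 0 /\ u^T *m M *m sigma = 0].

Definition space_N : set 'M[R]_n := if odd n then space_N_odd else space_N_even.

(* [space_P] and [space_Q] are only meaningful for even n, where nu = n./2.   *)
Definition space_P : set 'M[R]_n :=
  [set M : 'M[R]_n | forall i j : 'I_n,
     M i j + M (ord_shift n./2 i) (ord_shift n./2 j) = 0].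

Definition space_Q : set 'M[R]_n :=
  [set M : 'M[R]_n | forall i j : 'I_n,
     M i j - M (ord_shift n./2 i) (ord_shift n./2 j) = 0].

End Spaces.

(* The sets X and Y are (the carriers of) vector subspaces of E, and E is     *)
(* their direct sum.                                                          *)
Definition full_direct_sum {R : realType} {E : vectType R} (X Y : set E) :
    Prop :=
  exists U W : {vspace E},
    [/\ [set` U] = X, [set` W] = Y, directv (U + W) & (U + W)%VS = fullv].

(* Main.v *)
Require Import Defs.
From HB Require Import structures.
From mathcomp Require Import all_boot all_order all_algebra.
From mathcomp Require Import boolp classical_sets reals.
From mathcomp Require Import ring lra.

(* The pairs (B, A) and (Q, P) are the eigenspaces for 1 and -1 of an         *)
(* involution permuting the entries.  For (S, V), replacing each entry by     *)
(* (row mean) + (column mean) - 2 (total mean) is a projection with kernel S  *)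
(* and image V.  Finally M |-> ((-1)^(i+j) M_ij) carries N to S and M to V,   *)
(* for even as well as for odd n.                                             *)

Import Order.TTheory GRing.Theory Num.Theory.

Local Open Scope ring_scope.

(** * Direct sums from projections, involutions and transport *)

Section DirectSums.
Set Implicit Arguments.
Variables (R : realType) (E : vectType R).

(** An idempotent q splits the space into its kernel and its fixed vectors: x = (x - q x) + q x, and
    a vector both killed and fixed is 0. An involution t reduces to this through q = (1 - t) / 2;
    index reversal and the half-turn shift give (B, A) and (Q, P). For (S, V) the idempotent is
    [additive_part], extracting the component a_i + b_j of total 0. The pair (N, M) is the image of
    (S, V) under the sign change [checker], which turns [sigma] into the all-ones vector. For even n
    the sign also alternates across the wrap-around, so the local cyclic conditions become
    equalities of neighbours ([space_M_evenE], [space_N_evenE]). For odd n,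
    [orth_sigma_annihilatorP] converts orthogonality to [sigma] into entrywise equalities
    ([space_M_oddE], [space_N_oddE]). *)

Lemma full_direct_sum_projection (q : {linear E -> E}) (X Y : set E) :
    (forall x, q (q x) = q x) ->
    (forall x, X x <-> q x = 0) -> (forall x, Y x <-> q x = x) ->
  full_direct_sum X Y.
Proof.
move=> qq XE YE; pose f := linfun q.
exists (lker f), (lker (f - \1%VF)).
have fE x : f x = q x by rewrite lfunE.
have gE x : (f - \1%VF) x = q x - x by rewrite add_lfunE opp_lfunE id_lfunE fE.
split.
- apply/predeqP => x; apply: (iff_trans _ (iff_sym (XE x))) => /=.
  by rewrite memv_ker fE; split => [/eqP|->].
- apply/predeqP => x; apply: (iff_trans _ (iff_sym (YE x))) => /=.
  by rewrite memv_ker gE subr_eq0; split => [/eqP|->].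
- apply/directv_addP/eqP; rewrite -subv0; apply/subvP => x.
  rewrite memv_cap !memv_ker gE fE subr_eq0 => /andP[/eqP-> /eqP<-].
  exact: mem0v.
- apply/vspaceP => x; rewrite memvf -(subrK (q x) x); apply: memv_add.
    by rewrite memv_ker fE raddfB /= qq subrr.
  by rewrite memv_ker gE qq subrr.
Qed.

Lemma full_direct_sum_involution (t : {linear E -> E}) (X Y : set E) :
    (forall x, t (t x) = x) ->
    (forall x, X x <-> x - t x = 0) -> (forall x, Y x <-> x + t x = 0) ->
  full_direct_sum X Y.
Proof.
move=> tt XE YE; pose h : R := 2^-1.
have hD (x : E) : h *: x + h *: x = x.
  by rewrite -scalerDl -[h]mul1r -splitr scale1r.
(* The projection onto the eigenspace of [t] for -1, with the eigenspace for 1 as kernel. *)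
pose q x := h *: (x - t x).
have qlin : linear q.
  move=> a x y; rewrite /q linearP scalerA mulrC -scalerA -scalerDr.
  by rewrite [a *: (_ - _)]scalerBr opprD addrACA.
pose Q := GRing.isLinear.Build R E E *:%R q qlin.
pose q' : {linear E -> E} := HB.pack q Q.
apply: (full_direct_sum_projection q') => x /=.
- have tq : t (q x) = - q x.
    by rewrite /q linearZ /= [t (_ - _)]linearB /= tt -scalerN opprB.
  by rewrite {1}/q tq opprK scalerDr hD.
- rewrite /q; split=> [/XE->|]; first by rewrite scaler0.
  move/eqP; rewrite scaler_eq0 invr_eq0 pnatr_eq0 /= => /eqP ?; exact/XE.
- have xqx : x - q x = h *: (x + t x).
    by rewrite -{1}(hD x) /q scalerBr scalerDr opprB addrACA subrr addr0.
  rewrite YE; split=> [e|e].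
    by apply/eqP; rewrite eq_sym -subr_eq0 xqx e scaler0.
  move/eqP: xqx; rewrite e subrr eq_sym scaler_eq0 invr_eq0 pnatr_eq0 /=.
  by move/eqP.
Qed.

(** Since [t] is its own inverse, preimages under [t] are images under [t], hence again
    subspaces. *)
Lemma full_direct_sum_preimage (t : {linear E -> E}) (X Y X' Y' : set E) :
    (forall x, t (t x) = x) ->
    (forall x, X' x <-> X (t x)) -> (forall x, Y' x <-> Y (t x)) ->
  full_direct_sum X Y -> full_direct_sum X' Y'.
Proof.
move=> tt XE YE [U [W [UX WY dUW UW]]]; pose f := linfun t.
have fE x : f x = t x by rewrite lfunE.
have memf (Z : {vspace E}) x : (x \in (f @: Z)%VS) = (t x \in Z).
  apply/idP/idP => [/memv_imgP[y yZ ->]|tZ]; first by rewrite fE tt.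
  by rewrite -(tt x) -fE memv_img.
exists (f @: U)%VS, (f @: W)%VS; split.
- apply/predeqP => x; apply: (iff_trans _ (iff_sym (XE x))) => /=.
  by rewrite memf -UX.
- apply/predeqP => x; apply: (iff_trans _ (iff_sym (YE x))) => /=.
  by rewrite memf -WY.
- move/directv_addP: dUW => dUW.
  apply/directv_addP/eqP; rewrite -subv0; apply/subvP => x.
  rewrite memv_cap !memf -memv_cap dUW !memv0 => /eqP e.
  by rewrite -(tt x) e raddf0.
- by rewrite -limgD UW; apply/vspaceP => x; rewrite memf !memvf.
Qed.

End DirectSums.

(** * Cyclic indices and signs *)

Section Matrices.
Set Implicit Arguments.
Variables (R : realType) (n : nat).
Implicit Types M : 'M[R]_n.

(** Any index at hand forces n > 0, so entrywise arguments may divide by n although n = 0 is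
    allowed. *)
Let nzR : 'I_n -> n%:R != 0 :> R.
Proof. by case: n => [[]|m] // _; rewrite pnatr_eq0. Qed.

Lemma ord_shiftE k (i : 'I_n) : ord_shift n k i = ((i + k) %% n)%N :> nat.
Proof.
elim: k => [|k IHk] /=; first by rewrite addn0 modn_small.
by rewrite IHk -addn1 modnDml -addnA addn1.
Qed.

(** The successor acts transitively on the cycle: j + (n - i) steps lead from i to j. *)
Lemma ordS_invariant_const T (f : 'I_n -> T) :
  (forall i, f (ordS i) = f i) -> forall i j, f i = f j.
Proof.
move=> fS i j; have fk k : f (ord_shift n k i) = f i.
  by elim: k => //= k IHk; rewrite fS.
rewrite -(fk (j + (n - i))%N); congr f; apply: val_inj.
by rewrite /= ord_shiftE addnCA subnKC ?(ltnW (ltn_ord i)) // modnDr modn_small.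
Qed.

Lemma sign_ordS (i : 'I_n) : ~~ odd n -> (-1) ^+ ordS i = - (-1) ^+ i :> R.
Proof.
by move=> /negbTE en; rewrite -signr_odd /= odd_mod // signr_odd exprS mulN1r.
Qed.

Lemma full_direct_sum_index (s : 'I_n -> 'I_n) (X Y : set 'M[R]_n) :
    involutive s ->
    (forall M, X M <-> forall i j, M i j - M (s i) (s j) = 0) ->
    (forall M, Y M <-> forall i j, M i j + M (s i) (s j) = 0) ->
  full_direct_sum X Y.
Proof.
move=> sK XE YE.
apply: (full_direct_sum_involution (mxsub s s : {linear 'M_n -> 'M_n})) => M.
- by apply/matrixP => i j; rewrite !mxE !sK.
- apply: (iff_trans (XE M)); split=> [e|e i j].
    by apply/matrixP => i j; rewrite !mxE.
  by move/matrixP/(_ i j): e; rewrite !mxE.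
- apply: (iff_trans (YE M)); split=> [e|e i j].
    by apply/matrixP => i j; rewrite !mxE.
  by move/matrixP/(_ i j): e; rewrite !mxE.
Qed.

(** * The splitting into S and V *)

Definition row_sum M i : R := \sum_j M i j.
Definition col_sum M j : R := \sum_i M i j.
Definition total M : R := \sum_i \sum_j M i j.

Lemma sum_row_sum M : \sum_i row_sum M i = total M. Proof. by []. Qed.

Lemma sum_col_sum M : \sum_j col_sum M j = total M.
Proof. exact: exchange_big. Qed.

Lemma sum_const (c : R) : \sum_(i < n) c = n%:R * c.
Proof. by rewrite sumr_const card_ord mulr_natl. Qed.

Lemma space_SE M : space_S R n M <->
  (forall i k, row_sum M i = row_sum M k) /\
  (forall j l, col_sum M j = col_sum M l).
Proof.
split=> [[w wM]|[rM cM]].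
  split=> i k; first by rewrite /row_sum (wM i).1 (wM k).1.
  by rewrite /col_sum (wM i).2 (wM k).2.
(* Equal row sums and equal column sums share the value [total M / n], because both families add up
   to [total M]. *)
exists (total M / n%:R / n%:R) => i; have n0 := nzR i.
rewrite mulrCA divff // mulr1 -/(row_sum M i) -/(col_sum M i); split.
  apply: (mulfI n0); rewrite mulrCA divff // mulr1 -sum_row_sum -sum_const.
  by apply: eq_bigr.
apply: (mulfI n0); rewrite mulrCA divff // mulr1 -sum_col_sum -sum_const.
by apply: eq_bigr.
Qed.

(** The main effects of a two-way table. Row means and column means each contribute the overall mean
    once; subtracting it twice makes the total 0. *)
Definition additive_part M : 'M[R]_n :=
  \matrix_(i, j) ((row_sum M i + col_sum M j) / n%:R
                  - 2 * total M / n%:R / n%:R).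

Lemma additive_part_linear : linear additive_part.
Proof.
move=> a M N; apply/matrixP => i j; rewrite !mxE.
have rE k : row_sum (a *: M + N) k = a * row_sum M k + row_sum N k.
  by rewrite mulr_sumr -big_split; apply: eq_bigr => l _; rewrite !mxE.
have -> : col_sum (a *: M + N) j = a * col_sum M j + col_sum N j.
  by rewrite mulr_sumr -big_split; apply: eq_bigr => l _; rewrite !mxE.
have -> : total (a *: M + N) = a * total M + total N.
  rewrite -!sum_row_sum mulr_sumr -big_split.
  by apply: eq_bigr => k _; rewrite rE.
by rewrite rE; ring.
Qed.

HB.instance Definition _ :=
  GRing.isLinear.Build R 'M[R]_n 'M[R]_n *:%R additive_part
    additive_part_linear.

(** Row sums change only by a constant, which together with the column analogue and the vanishing
    total gives idempotence. *)
Lemma row_sum_additive_part M i :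
  row_sum (additive_part M) i = row_sum M i - total M / n%:R.
Proof.
have n0 := nzR i; rewrite {1}/row_sum.
under eq_bigr do rewrite mxE.
rewrite sumrB -mulr_suml big_split /= sum_col_sum !sum_const.
by field.
Qed.

Lemma col_sum_additive_part M j :
  col_sum (additive_part M) j = col_sum M j - total M / n%:R.
Proof.
have n0 := nzR j; rewrite {1}/col_sum.
under eq_bigr do rewrite mxE.
rewrite sumrB -mulr_suml big_split /= sum_row_sum !sum_const.
by field.
Qed.

Lemma total_additive_part M : total (additive_part M) = 0.
Proof.
rewrite -sum_row_sum; under eq_bigr do rewrite row_sum_additive_part.
rewrite sumrB sum_row_sum sum_const.
case: (posnP n) => [n0|n_gt0]; last by field; rewrite pnatr_eq0 -lt0n.
have empty (i : 'I_n) : False by have : (i < 0)%N by rewrite -n0.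
by rewrite /total big1 ?mul0r ?mulr0 ?subr0 // => i; case: (empty i).
Qed.

Lemma full_direct_sum_S_V : full_direct_sum (space_S R n) (space_V R n).
Proof.
apply: (full_direct_sum_projection (additive_part : {linear _ -> _})) => M /=.
- apply/matrixP => i j; have n0 := nzR i.
  rewrite [LHS]mxE row_sum_additive_part col_sum_additive_part.
  by rewrite total_additive_part mxE; field.
- rewrite space_SE; split=> [[rM cM]|M0].
    apply/matrixP => i j; have n0 := nzR i; rewrite !mxE.
    have rt : n%:R * row_sum M i = total M.
      by rewrite -sum_row_sum -sum_const; apply: eq_bigr.
    have ct : n%:R * col_sum M j = total M.
      by rewrite -sum_col_sum -sum_const; apply: eq_bigr.
    have -> : 2 * total M = n%:R * (row_sum M i + col_sum M j).
      by rewrite mulrDr rt ct; ring.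
    by field.
  (* The left side minus the right side is a row sum of [additive_part M], here the zero matrix. *)
  have rM i : row_sum M i = total M / n%:R.
    apply/eqP; rewrite -subr_eq0 -row_sum_additive_part M0; apply/eqP.
    by apply: big1 => j _; rewrite mxE.
  have cM j : col_sum M j = total M / n%:R.
    apply/eqP; rewrite -subr_eq0 -col_sum_additive_part M0; apply/eqP.
    by apply: big1 => i _; rewrite mxE.
  by split=> i k; rewrite ?rM ?cM.
- split=> [[addM tM]|<-]; last first.
    split; last exact: total_additive_part.
    by move=> i j k l; rewrite !mxE; ring.
  apply/matrixP => i j; have n0 := nzR i; rewrite mxE.
  (* The exchange identity is summed over all k and l with i and j fixed. *)
  have sM : n%:R * (n%:R * M i j) + total M
          = n%:R * row_sum M i + n%:R * col_sum M j.
    transitivity (\sum_k \sum_l (M i j + M k l)).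
      under [RHS]eq_bigr do rewrite big_split /= sum_const.
      by rewrite big_split /= sum_const.
    transitivity (\sum_k \sum_l (M i l + M k j)).
      by apply: eq_bigr => k _; apply: eq_bigr => l _.
    under eq_bigr do rewrite big_split /= sum_const.
    by rewrite big_split /= sum_const -mulr_sumr.
  have -> : row_sum M i + col_sum M j = n%:R * M i j.
    by apply: (mulfI n0); rewrite mulrDr -sM /total tM addr0.
  by rewrite /total tM; field.
Qed.

(** * Checkerboard signs, and N and M for even n *)

Definition checker M : 'M[R]_n := \matrix_(i, j) ((-1) ^+ (i + j) * M i j).

Lemma checker_linear : linear checker.
Proof. by move=> a M N; apply/matrixP => i j; rewrite !mxE; ring. Qed.

HB.instance Definition _ :=
  GRing.isLinear.Build R 'M[R]_n 'M[R]_n *:%R checker checker_linear.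

Lemma checkerK : involutive checker.
Proof.
by move=> M; apply/matrixP => i j; rewrite !mxE mulrA -expr2 sqrr_sign mul1r.
Qed.

(** The signs turn sums over cyclic 2 x 2 blocks into mixed second differences; their vanishing
    propagates around the cycle in both directions. *)
Lemma space_M_evenE M :
  ~~ odd n -> space_M_even R n M <-> space_V R n (checker M).
Proof.
move=> en.
have tE : \sum_(i < n) \sum_(j < n) (-1) ^+ (i.+1 + j.+1) * M i j
        = \sum_i \sum_j checker M i j.
  apply: eq_bigr => i _; apply: eq_bigr => j _.
  by rewrite mxE addSn addnS !exprS !mulN1r opprK.
pose s (i : 'I_n) : R := (-1) ^+ i.
have ME i j : M i j = s i * s j * checker M i j.
  by rewrite -{1}(checkerK M) mxE exprD.
have sS i : s (ordS i) = - s i by exact: sign_ordS.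
have s0 i : s i != 0 by rewrite signr_eq0.
rewrite /space_M_even /space_V /= tE; move: (checker M) ME => C ME.
split=> -[H tC]; split=> // i j.
  move=> k l.
  have locC a b : C a b - C (ordS a) b = C a (ordS b) - C (ordS a) (ordS b).
    have: s a * s b * (C a b - C (ordS a) b
                       - (C a (ordS b) - C (ordS a) (ordS b))) = 0.
      by rewrite -(H a b) !ME !sS; ring.
    move/eqP; rewrite !mulf_eq0 !(negbTE (s0 _)) subr_eq0 => /eqP; exact.
  (* First the column index is moved freely, then in [colC] the row index. *)
  have rowC a b c : C a b - C (ordS a) b = C a c - C (ordS a) c.
    by apply: (ordS_invariant_const (fun b => C a b - C (ordS a) b)).
  have colC : C i j - C i l = C k j - C k l.
    apply: (ordS_invariant_const (fun a => C a j - C a l)) => a.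
    by have := rowC a j l; lra.
  by move: colC; lra.
rewrite !ME !sS.
have -> : C i j = C i (ordS j) + C (ordS i) j - C (ordS i) (ordS j).
  by rewrite -H addrK.
by ring.
Qed.

(** Up to sign, the alternating sums are differences of consecutive row or column sums of
    [checker M]. *)
Lemma space_N_evenE M :
  ~~ odd n -> space_N_even R n M <-> space_S R n (checker M).
Proof.
move=> en; rewrite space_SE.
pose s (i : 'I_n) : R := (-1) ^+ i.
have ME i j : M i j = s i * s j * checker M i j.
  by rewrite -{1}(checkerK M) mxE exprD.
have sS i : s (ordS i) = - s i by exact: sign_ordS.
have s0 i : s i != 0 by rewrite signr_eq0.
have ss i : s i * s i = 1 by rewrite -expr2 sqrr_sign.
have cE j : \sum_(i < n) (-1) ^+ i.+1 * (M i j + M i (ordS j))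
    = s j * (col_sum (checker M) (ordS j) - col_sum (checker M) j).
  rewrite -sumrB mulr_sumr; apply: eq_bigr => i _.
  (* The factor [s i * s i] is inserted on the right because [ring] does not know that it equals
     1. *)
  rewrite exprS -/(s i) !ME sS -[RHS]mul1r -[in RHS](ss i); ring.
have rE j : \sum_(i < n) (-1) ^+ i.+1 * (M j i + M (ordS j) i)
    = s j * (row_sum (checker M) (ordS j) - row_sum (checker M) j).
  rewrite -sumrB mulr_sumr; apply: eq_bigr => i _.
  rewrite exprS -/(s i) !ME sS -[RHS]mul1r -[in RHS](ss i); ring.
split=> [H|[rC cC] j].
  split; apply: ordS_invariant_const => j; have [cj rj] := H j.
    move/eqP: rj; rewrite rE mulf_eq0 (negbTE (s0 _)) subr_eq0 => /eqP; exact.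
  move/eqP: cj; rewrite cE mulf_eq0 (negbTE (s0 _)) subr_eq0 => /eqP; exact.
by rewrite cE rE (rC _ j) (cC _ j) !subrr mulr0.
Qed.

(** * N and M for odd n, through the hyperplane orthogonal to [sigma] *)

Local Notation sg := (sigma R n).

Lemma orth_sigmaP (u : 'cV[R]_n) :
  orth R n [set sg]%classic u <-> u^T *m sg = 0.
Proof. by split=> [/(_ sg erefl)|u0 _ ->]. Qed.

(** A functional vanishing on this hyperplane is a multiple of [sigma^T]; equality of the signed
    entries expresses this without naming the factor. *)
Lemma orth_sigma_annihilatorP (w : 'rV[R]_n) :
  (forall u, orth R n [set sg]%classic u -> w *m u = 0) <->
  (forall j l : 'I_n, (-1) ^+ j * w 0 j = (-1) ^+ l * w 0 l).
Proof.
split=> [wu j l|wc u /orth_sigmaP u0].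
  pose u : 'cV[R]_n := (-1) ^+ j *: delta_mx j 0 - (-1) ^+ l *: delta_mx l 0.
  have /wu : orth R n [set sg]%classic u.
    apply/orth_sigmaP; rewrite /u [X in X *m _]linearB /=.
    rewrite ![(_ *: _)^T]linearZ /= !trmx_delta mulmxBl.
    rewrite -!scalemxAl -!rowE; apply/matrixP => a b.
    by rewrite !mxE -!expr2 !sqrr_sign subrr.
  rewrite /u mulmxBr -!scalemxAr -!colE => /matrixP/(_ 0 0).
  by rewrite !mxE => /eqP; rewrite subr_eq0 => /eqP.
apply/matrixP => a b; rewrite !ord1 !mxE.
case: (posnP n) => [n0|n_gt0].
  by apply: big1 => i; have : (i < 0)%N by rewrite -n0.
pose j0 := Ordinal n_gt0.
(* The common signed entry, read off at [j0], is the factor. *)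
have -> : \sum_j w 0 j * u j 0
        = (-1) ^+ j0 * w 0 j0 * (u^T *m sg) 0 0.
  rewrite mxE mulr_sumr; apply: eq_bigr => j _; rewrite !mxE (wc j0 j).
  by rewrite -[LHS]mul1r -[in LHS](sqrr_sign R j); ring.
by rewrite u0 mxE mulr0.
Qed.

(** The signed entries of [sg^T *m M] and [M *m sg] are the column and row sums of [checker M], so
    the annihilator criterion applies to each. *)
Lemma space_N_oddE M : space_N_odd R n M <-> space_S R n (checker M).
Proof.
rewrite space_SE.
have cE (j : 'I_n) : (-1) ^+ j * (sg^T *m M) 0 j = col_sum (checker M) j.
  rewrite mxE mulr_sumr; apply: eq_bigr => i _.
  by rewrite !mxE mulrA addnC exprD.
have rE (j : 'I_n) : (-1) ^+ j * (M *m sg)^T 0 j = row_sum (checker M) j.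
  rewrite !mxE mulr_sumr; apply: eq_bigr => i _.
  by rewrite !mxE exprD; ring.
have trE u : (u^T *m M *m sg = 0) <-> ((M *m sg)^T *m u = 0).
  rewrite -mulmxA; split=> e; apply: trmx_inj; rewrite trmx_mul trmxK.
    by rewrite e raddf0.
  by rewrite e raddf0.
have [c1 c2] := orth_sigma_annihilatorP (sg^T *m M).
have [r1 r2] := orth_sigma_annihilatorP (M *m sg)^T.
split=> [H|[rC cC] u uo].
  split=> j l; rewrite -?rE -?cE.
    by apply: r1 => u /H[_ /trE].
  by apply: c1 => u /H[].
split; first by apply: c2 => // j l; rewrite !cE.
by apply/trE; apply: r2 => // j l; rewrite !rE.
Qed.

(** The annihilator criterion is applied to the bilinear form in each variable: in v it equates
    signed entries of u^T M, that is, makes u annihilate the signed column differences [D j l]; in u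
    it then yields the exchange identity for [checker M]. *)
Lemma space_M_oddE M : space_M_odd R n M <-> space_V R n (checker M).
Proof.
have tE : (sg^T *m M *m sg) 0 0 = \sum_i \sum_j checker M i j.
  rewrite exchange_big mxE; apply: eq_bigr => j _.
  rewrite !mxE mulr_suml; apply: eq_bigr => i _.
  by rewrite !mxE exprD mulrAC.
have t0 : (sg^T *m M *m sg = 0) <-> (\sum_i \sum_j checker M i j = 0).
  rewrite -tE; split=> [->|e]; first by rewrite mxE.
  by apply/matrixP => i j; rewrite !ord1 e mxE.
pose D (j l : 'I_n) : 'cV[R]_n := (-1) ^+ j *: col j M - (-1) ^+ l *: col l M.
have DE (i j l : 'I_n) :
    (-1) ^+ i * (D j l)^T 0 i = checker M i j - checker M i l.
  by rewrite !mxE !exprD; ring.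
have uDE (u : 'cV[R]_n) j l : ((D j l)^T *m u) 0 0
    = (-1) ^+ j * (u^T *m M) 0 j - (-1) ^+ l * (u^T *m M) 0 l.
  rewrite !mxE !mulr_sumr -sumrB; apply: eq_bigr => i _.
  by rewrite !mxE; ring.
have uD (u : 'cV[R]_n) (j l : 'I_n) : (D j l)^T *m u = 0 <->
    (-1) ^+ j * (u^T *m M) 0 j = (-1) ^+ l * (u^T *m M) 0 l.
  split=> [e|e]; first by apply/eqP; rewrite -subr_eq0 -uDE e mxE.
  by apply/matrixP => a b; rewrite !ord1 uDE e subrr mxE.
have addE i j k l : (checker M i j + checker M k l
      = checker M i l + checker M k j) <->
    (checker M i j - checker M i l = checker M k j - checker M k l).
  by split; lra.
have addP : (forall u v : 'cV[R]_n, orth R n [set sg]%classic u ->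
      orth R n [set sg]%classic v -> u^T *m M *m v = 0) <->
    (forall i j k l, checker M i j + checker M k l
      = checker M i l + checker M k j).
  split=> [H i j k l|H u v uo].
    apply/addE; rewrite -!DE; move: i k.
    apply/(orth_sigma_annihilatorP (D j l)^T) => u uo; apply/uD.
    by move: j l; apply/(orth_sigma_annihilatorP (u^T *m M)) => v; apply: H.
  move: v; apply/(orth_sigma_annihilatorP (u^T *m M)) => j l; apply/uD.
  move: u uo; apply/(orth_sigma_annihilatorP (D j l)^T) => i k.
  by rewrite !DE; apply/addE.
by split=> -[/addP H /t0 t].
Qed.

Lemma full_direct_sum_N_M : full_direct_sum (space_N R n) (space_M R n).
Proof.
apply: (full_direct_sum_preimage (checker : {linear _ -> _}) _ _
         checkerK _ _ full_direct_sum_S_V) => M.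
- rewrite /space_N; case: ifPn => on; first exact: space_N_oddE.
  exact: space_N_evenE.
- rewrite /space_M; case: ifPn => on; first exact: space_M_oddE.
  exact: space_M_evenE.
Qed.

Lemma ord_shift_half_involutive : ~~ odd n -> involutive (ord_shift n n./2).
Proof.
move=> en i; apply: val_inj; rewrite /= !ord_shiftE modnDml -addnA addnn.
by rewrite even_halfK // modnDr modn_small.
Qed.

End Matrices.

Theorem corollary1 (R : realType) (n : nat) :
  [/\ full_direct_sum (space_B R n) (space_A R n),
      full_direct_sum (space_S R n) (space_V R n),
      full_direct_sum (space_N R n) (space_M R n)
    & ~~ odd n -> full_direct_sum (space_Q R n) (space_P R n)].
Proof.
split.
- by apply: (full_direct_sum_index _ _ _ (@rev_ordK n)).
- exact: full_direct_sum_S_V.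
- exact: full_direct_sum_N_M.
- move=> /ord_shift_half_involutive sK.
  by apply: (full_direct_sum_index _ _ _ sK).
Qed.
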